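(* Let $\epsilon<1/6$. There is no algorithm which, for every graph $G$, takes a total of $s$ adaptive random walk steps in $G$ and outputs a distribution $q$ with $W_1(p_G,q)\le\epsilon$ with probability greater than $3/4$, unless $s\ge 1/(36\epsilon^2)$. Here $p_G$ is the spectral density of $G$.
   Context: For a (possibly weighted) graph $G$ with weighted adjacency matrix $\tilde A$ and diagonal degree matrix $D$ of row sums of $\tilde A$, the normalized adjacency matrix is $A(G)=D^{-1/2}\tilde A D^{-1/2}$, and the spectral density $p_G$ is the uniform distribution over its eigenvalues (with multiplicity). A random walk step from $v$ goes to $v'$ with probability $\tilde A(v,v')/D(v,v)$. In the adaptive random walk model, the algorithm may start random walks (of any length) either at a uniformly random vertex or at any vertex of its choosing (chosen adaptively based on previous observations), and observes the full sequence of vertex labels visited; $s$ counts the total number of random walk steps. $W_1$ is the Wasserstein-1 distance. *)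

(* Defs.v *)
From HB Require Import structures.
From mathcomp Require Import all_boot all_order all_algebra.
From mathcomp Require Import spectral.
From mathcomp.real_closed Require Import complex.
From mathcomp Require Import all_classical all_reals all_analysis.

Set Implicit Arguments.
Unset Strict Implicit.
Unset Printing Implicit Defensive.

Import Order.TTheory GRing.Theory Num.Theory.
Import numFieldNormedType.Exports.
Local Open Scope classical_set_scope.
Local Open Scope ring_scope.

(* No vertex is isolated, so that D^{-1/2} and the random walk are defined.
   Unweighted graphs are those with weights in {0, 1}. *)
Record wgraph (R : realType) (n : nat) := WGraph {
  weight :> 'M[R]_n;
  weight_sym : weight^T = weight;
  weight_ge0 : forall i j, 0 <= weight i j;
  weight_loopless : forall i, weight i i = 0;
  weight_deg_gt0 : forall i, 0 < \sum_j weight i j }.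

Section Spectrum.
Variables (R : realType) (n : nat).
Implicit Type G : wgraph R n.

Definition degree G (i : 'I_n) : R := \sum_j G i j.

Definition inv_sqrt_degree G : 'M[R]_n :=
  diag_mx (\row_i (Num.sqrt (degree G i))^-1).

Definition normalized_adjacency G : 'M[R]_n :=
  inv_sqrt_degree G *m G *m inv_sqrt_degree G.

Lemma normalized_adjacency_sym G :
  (normalized_adjacency G)^T = normalized_adjacency G.
Proof.
by rewrite /normalized_adjacency !trmx_mul tr_diag_mx weight_sym mulmxA.
Qed.

Lemma char_poly_sym_split (A : 'M[R]_n) : A^T = A ->
  exists s : seq R, char_poly A = \prod_(l <- s) ('X - l%:P).
Proof.
move=> Asym; pose f : {rmorphism R -> complex R} :=
  real_complex R.
pose B := map_mx f A.
have freal (x : R) : f x \is Num.real by rewrite complex_real.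
have Bherm : B \is hermsymmx.
  apply: realsym_hermsym.
    apply/is_hermitianmxP; rewrite expr0 scale1r; apply/matrixP => i j.
    by rewrite !mxE -[in LHS]Asym mxE.
  by apply/mxOverP => i j; rewrite mxE.
have := hermitian_spectral_diag_real Bherm => /mxOverP dreal.
have /orthomx_spectralP Bspec := hermitian_normalmx Bherm.
set D := spectral_diag B in dreal Bspec.
have ReD i : exists x : R, D 0 i = f x.
  exists (complex.Re (D 0 i)).
  by rewrite -[LHS]RRe_real.
have [e eE] := choice ReD.
exists [seq e i | i <- enum 'I_n].
apply: (map_poly_inj f); rewrite map_char_poly -/B.
rewrite rmorph_prod big_map big_enum /=.
under eq_bigr do rewrite map_polyXsubC -eE.
have PU := spectral_unit B.
transitivity (char_poly (diag_mx D)); last first.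
  rewrite char_poly_trig ?diag_mx_is_trig //.
  by apply: eq_bigr => i _; rewrite mxE eqxx mulr1n.
rewrite [in LHS]Bspec /char_poly /char_poly_mx.
set P := spectralmx B.
have -> : 'X%:M - map_mx polyC (invmx P *m diag_mx D *m P) =
    map_mx polyC (invmx P) *m ('X%:M - map_mx polyC (diag_mx D)) *m map_mx polyC P.
  rewrite mulmxBr mulmxBl -!map_mxM; congr (_ - _).
  by rewrite mul_mx_scalar -scalemxAl -map_mxM mulVmx // map_mx1 scalemx1.
rewrite !det_mulmx mulrAC -det_mulmx -map_mxM mulVmx //.
by rewrite map_mx1 det1 mul1r.
Qed.

(* The roots of the characteristic polynomial, with multiplicity. *)
Definition eigenvalues G : seq R :=
  sval (cid (char_poly_sym_split (normalized_adjacency_sym G))).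

Lemma eigenvaluesP G :
  char_poly (normalized_adjacency G) =
  \prod_(l <- eigenvalues G) ('X - l%:P).
Proof. by rewrite /eigenvalues; case: cid. Qed.

Lemma size_eigenvalues G : size (eigenvalues G) = n.
Proof.
have := size_char_poly (normalized_adjacency G).
by rewrite eigenvaluesP size_prod_XsubC => -[].
Qed.

End Spectrum.

Section SpectralDensity.
Variables (R : realType) (n : nat) (G : wgraph R n.+1).

Definition spectral_density : set (measurableTypeR R) -> \bar R :=
  mscale (n.+1%:R^-1)%:nng
    (msum (fun k => @dirac _ (measurableTypeR R) (nth 0 (eigenvalues G) k) R)
      n.+1).

HB.instance Definition _ := Measure.on spectral_density.

Let spectral_density_setT : spectral_density setT = 1%:E.
Proof.
have -> : spectral_density setT =
    ((n.+1%:R^-1)%:E * \sum_(k < n.+1)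
       @dirac _ (measurableTypeR R) (nth 0%R (eigenvalues G) k) R setT)%E by [].
rewrite (eq_bigr (fun=> 1%E)) => [|k _]; last exact: diracT.
by rewrite sumEFin sumr_const card_ord -EFinM mulVf // pnatr_eq0.
Qed.

HB.instance Definition _ :=
  Measure_isProbability.Build _ _ _ spectral_density spectral_density_setT.

End SpectralDensity.

Section Wasserstein.
Variable R : realType.
Local Open Scope ereal_scope.
Notation line := (measurableTypeR R).

Definition coupling (p q : probability line R)
    (pi : probability (line * line)%type R) : Prop :=
  (forall B, measurable B -> pi (B `*` setT) = p B) /\
  (forall B, measurable B -> pi (setT `*` B) = q B).

Definition W1 (p q : probability line R) : \bar R :=
  ereal_inf [set \int[pi]_z `|z.1 - z.2|%:E | pi in coupling p q].

End Wasserstein.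

Section AdaptiveWalks.
Variable R : realType.

Variant start (n : nat) := UniformVertex | AtVertex of 'I_n.

(* The deterministic part of an algorithm, once its internal random seed is
   fixed: either output a distribution, or run a walk of [len] steps, observe
   all [len.+1] visited vertices and continue depending on them. *)
Inductive strategy (n : nat) :=
| Output of probability (measurableTypeR R) R
| Walk (u : start n) (len : nat) of ((len.+1).-tuple 'I_n -> strategy n).

Fixpoint total_steps n (t : strategy n) : nat :=
  match t with
  | Output _ => 0
  | Walk _ len k =>
      (len + \max_(w : (len.+1).-tuple 'I_n) total_steps (k w))%N
  end.

Definition start_prob n (u : start n) (v : 'I_n) : R :=
  match u with
  | UniformVertex => n%:R^-1
  | AtVertex v0 => (v == v0)%:R
  end.

Definition step_prob n (G : wgraph R n) (v v' : 'I_n) : R :=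
  G v v' / degree G v.

Definition walk_prob n (G : wgraph R n) (u : start n) (len : nat)
    (w : (len.+1).-tuple 'I_n) : R :=
  start_prob u (tnth w ord0) *
  \prod_(i < len)
    step_prob G (tnth w (widen_ord (leqnSn len) i)) (tnth w (lift ord0 i)).

Fixpoint output_prob n (G : wgraph R n)
    (E : set (probability (measurableTypeR R) R)) (t : strategy n) : R :=
  match t with
  | Output q => (`[< E q >])%:R
  | Walk u len k =>
      \sum_(w : (len.+1).-tuple 'I_n) walk_prob G u w * output_prob G E (k w)
  end.

(* A randomized algorithm: for each random seed and each number n.+1 of
   vertices, a strategy on graphs with vertex set 'I_n.+1. *)
Definition algorithm (T : Type) := T -> forall n, strategy n.+1.

(* The probability, over the walks only, that the algorithm with seed [w]
   outputs a distribution at distance at most [eps] from the spectral density *)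
Definition success_prob (T : Type) (A : algorithm T) (eps : R)
    n (G : wgraph R n.+1) (w : T) : R :=
  output_prob G
    [set q | (W1 (spectral_density G : probability _ _) q <= eps%:E)%E] (A w n).

End AdaptiveWalks.

(* Main.v *)
(** Two weighted 4-cycles are hard to tell apart: with alternating weights
    1/2 + dl and 1/2 - dl the normalized adjacency matrix has eigenvalues
    1, -1, 2 dl, -2 dl, so testing against the 1-Lipschitz function |x| shows
    that no q is within eps of both the spectral density for dl = 0 and the one
    for dl = 2.1 eps.  An accurate algorithm therefore separates the two graphs
    with total variation more than 1/2.  But the Hellinger affinity of one step,
    from any vertex, is a constant r with 1 - r^2 <= 2 dl^2; affinities multiply
    along adaptive walks, so the squared total variation after s steps is at
    most 1 - r^(2s) <= 2 s dl^2, which is below 1/4 if s < 1 / (36 eps^2). *)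

Require Import Defs.
From mathcomp Require Import all_boot all_order all_algebra.
From mathcomp Require Import all_classical all_reals all_analysis.
From mathcomp Require Import measurable_realfun ring lra.

Set Implicit Arguments.
Unset Strict Implicit.
Unset Printing Implicit Defensive.

Import Order.TTheory GRing.Theory Num.Theory.
Local Open Scope ring_scope.

(** * Hellinger affinity of two-point laws *)

Section Affinity.
Context {R : realType}.

(** The Hellinger affinity (Bhattacharyya coefficient) of the Bernoulli laws with parameters [a] and
    [c]. *)
Definition affinity (a c : R) : R :=
  Num.sqrt (a * c) + Num.sqrt ((1 - a) * (1 - c)).

(** Two-term Cauchy-Schwarz: after squaring, the cross terms compare by AM-GM on [x * w] and
    [z * y]. *)
Lemma sqrtrM_add (x y z w : R) : 0 <= x -> 0 <= y -> 0 <= z -> 0 <= w ->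
  Num.sqrt (x * y) + Num.sqrt (z * w) <= Num.sqrt ((x + z) * (y + w)).
Proof.
move=> x0 y0 z0 w0.
rewrite -(@ler_pXn2r _ 2) ?nnegrE ?addr_ge0 ?sqrtr_ge0 //.
rewrite sqr_sqrtr ?mulr_ge0 ?addr_ge0 // sqrrD !sqr_sqrtr ?mulr_ge0 //.
have -> : Num.sqrt (x * y) * Num.sqrt (z * w) =
    Num.sqrt (x * w) * Num.sqrt (z * y).
  by rewrite -!sqrtrM ?mulr_ge0 //; congr Num.sqrt; ring.
have := sqr_ge0 (Num.sqrt (x * w) - Num.sqrt (z * y)).
rewrite sqrrB !sqr_sqrtr ?mulr_ge0 //; nra.
Qed.

Lemma sum_sqrtrM (I : finType) (f g : I -> R) :
  (forall i, 0 <= f i) -> (forall i, 0 <= g i) ->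
  \sum_i Num.sqrt (f i * g i) <= Num.sqrt ((\sum_i f i) * \sum_i g i).
Proof.
move=> f0 g0.
suff [] : [/\ \sum_i Num.sqrt (f i * g i) <=
    Num.sqrt ((\sum_i f i) * \sum_i g i), 0 <= \sum_i f i
    & 0 <= \sum_i g i] by [].
elim/big_rec3: _ => [|i F G S _ [le_S F0 G0]]; first by rewrite mulr0 sqrtr0.
split; rewrite ?addr_ge0 //.
by apply: le_trans (sqrtrM_add (f0 i) (g0 i) F0 G0); rewrite lerD2l.
Qed.

Lemma sqrtr_prod (I : finType) (f : I -> R) : (forall i, 0 <= f i) ->
  Num.sqrt (\prod_i f i) = \prod_i Num.sqrt (f i).
Proof.
move=> f0; elim/big_rec2: _ => [|i S F _ <-]; first by rewrite sqrtr1.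
by rewrite sqrtrM.
Qed.

(** AM-GM bounds twice the cross term by [a (1 - a) + c (1 - c)], after which everything sums to
    exactly 1. As [|a - c|] is the total variation distance, affinity near 1 forces close
    probabilities. *)
Lemma sqr_affinity_le (a c : R) : 0 <= a <= 1 -> 0 <= c <= 1 ->
  affinity a c ^+ 2 + (a - c) ^+ 2 <= 1.
Proof.
move=> /andP[a0 a1] /andP[c0 c1]; rewrite /affinity.
have a1' : 0 <= 1 - a by lra.
have c1' : 0 <= 1 - c by lra.
rewrite sqrrD !sqr_sqrtr ?mulr_ge0 //.
have -> : Num.sqrt (a * c) * Num.sqrt ((1 - a) * (1 - c)) =
    Num.sqrt (a * (1 - a)) * Num.sqrt (c * (1 - c)).
  by rewrite -!sqrtrM ?mulr_ge0 //; congr Num.sqrt; ring.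
have := sqr_ge0 (Num.sqrt (a * (1 - a)) - Num.sqrt (c * (1 - c))).
rewrite sqrrB !sqr_sqrtr ?mulr_ge0 //; nra.
Qed.

Lemma bernoulli_le (x : R) (k : nat) : 0 <= x <= 1 ->
  1 - x *+ k <= (1 - x) ^+ k.
Proof.
move=> /andP[x0 x1]; elim: k => [|k IH]; first by rewrite mulr0n subr0 expr0.
have {}IH : 1 - k%:R * x <= (1 - x) ^+ k by rewrite mulr_natl.
rewrite -mulr_natl -natr1 exprS.
have k0 : 0 <= k%:R :> R by [].
have : (1 - x) * (1 - k%:R * x) <= (1 - x) * (1 - x) ^+ k.
  by rewrite ler_wpM2l // subr_ge0.
by apply: le_trans; nra.
Qed.

End Affinity.

(** * Random walks and adaptive transcripts *)

Section Walks.
Context {R : realType}.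

Lemma big_tupleS (n m : nat) (F : m.+1.-tuple 'I_n -> R) :
  \sum_w F w = \sum_v \sum_(t : m.-tuple 'I_n) F [tuple of v :: t].
Proof.
rewrite pair_big /=.
rewrite (reindex (fun p : 'I_n * m.-tuple 'I_n => [tuple of p.1 :: p.2])) //=.
exists (fun w => (thead w, [tuple of behead w])) => [[v t] _|w _] /=.
  by congr pair; apply: val_inj.
by rewrite [RHS]tuple_eta.
Qed.

(** Serves both for the transition kernel, with [r = 1], and for the entrywise geometric mean of two
    kernels, with [r] their affinity. *)
Lemma sum_walk (n len : nat) (K : 'I_n -> 'I_n -> R) (r : R) (st : 'I_n -> R) :
  (forall i, \sum_j K i j = r) ->
  \sum_(w : len.+1.-tuple 'I_n) st (tnth w ord0) *
     \prod_(i < len)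
       K (tnth w (widen_ord (leqnSn len) i)) (tnth w (lift ord0 i)) =
  (\sum_v st v) * r ^+ len.
Proof.
move=> sumK; elim: len st => [|len IH] st; rewrite big_tupleS.
  rewrite expr0 mulr1; apply: eq_bigr => v _.
  under eq_bigr do rewrite tnth0 big_ord0 mulr1.
  by rewrite sumr_const card_tuple expn0 mulr1n.
rewrite mulr_suml; apply: eq_bigr => v _.
(* After the first vertex [v], the tail is a walk with initial weight [K v]; hence the induction
   over all [st]. *)
transitivity (st v * \sum_(t : len.+1.-tuple 'I_n) K v (tnth t ord0) *
    \prod_(i < len)
      K (tnth t (widen_ord (leqnSn len) i)) (tnth t (lift ord0 i))).
  rewrite mulr_sumr; apply: eq_bigr => t _.
  rewrite tnth0 big_ord_recl; congr (_ * (_ * _)).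
    by rewrite tnthS; congr K; rewrite -(tnth0 v t); congr tnth; apply: val_inj.
  apply: eq_bigr => i _; rewrite !tnthS; congr K.
  by rewrite -[RHS](tnthS v); congr tnth; apply: val_inj.
by rewrite IH sumK -exprS.
Qed.

Context {n : nat}.
Implicit Types (G : wgraph R n.+1) (u : start n.+1) (t : strategy R n.+1).

Lemma degree_gt0 G i : 0 < degree G i.
Proof. exact: weight_deg_gt0. Qed.

Lemma step_prob_ge0 G v v' : 0 <= step_prob G v v'.
Proof. by rewrite divr_ge0 ?weight_ge0 // ltW // degree_gt0. Qed.

Lemma sum_step_prob G v : \sum_v' step_prob G v v' = 1.
Proof. by rewrite -mulr_suml divff // gt_eqF // degree_gt0. Qed.

Lemma start_prob_ge0 u v : 0 <= start_prob R u v.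
Proof. by case: u => [|v0] /=. Qed.

Lemma sum_start_prob u : \sum_v start_prob R u v = 1.
Proof.
case: u => [|v0] /=.
  by rewrite sumr_const card_ord -[_ *+ n.+1]mulr_natr mulVf // pnatr_eq0.
by rewrite (bigD1 v0) //= eqxx big1 ?addr0 // => v /negPf->.
Qed.

Lemma walk_prob_ge0 G u len (w : len.+1.-tuple 'I_n.+1) : 0 <= walk_prob G u w.
Proof.
rewrite mulr_ge0 ?start_prob_ge0 //; apply: prodr_ge0 => i _.
exact: step_prob_ge0.
Qed.

Lemma sum_walk_prob G u len :
  \sum_(w : len.+1.-tuple 'I_n.+1) walk_prob G u w = 1.
Proof.
by rewrite (sum_walk _ _ (sum_step_prob G)) expr1n mulr1 sum_start_prob.
Qed.

(** Both walks start from the same law, so the start contributes a factor 1 and only the steps lose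
    affinity. *)
Lemma sum_sqrt_walk_prob G G' u len (r : R) :
  (forall v, \sum_v' Num.sqrt (step_prob G v v' * step_prob G' v v') = r) ->
  \sum_(w : len.+1.-tuple 'I_n.+1)
     Num.sqrt (walk_prob G u w * walk_prob G' u w) = r ^+ len.
Proof.
move=> rE; rewrite -[RHS]mul1r -(sum_start_prob u) -(sum_walk _ _ rE).
apply: eq_bigr => w _; rewrite /walk_prob mulrACA -big_split /=.
rewrite sqrtrM ?mulr_ge0 ?start_prob_ge0 //.
rewrite -expr2 sqrtr_sqr ger0_norm ?start_prob_ge0 // sqrtr_prod // => i.
by rewrite mulr_ge0 ?step_prob_ge0.
Qed.

Lemma output_prob_setC G E t :
  output_prob G (~` E)%classic t = 1 - output_prob G E t.
Proof.
elim: t => [q|u len k IH] /=.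
  by rewrite /setC /= asbool_neg; case: asbool; rewrite ?subrr ?subr0.
rewrite -(sum_walk_prob G u len) -sumrB; apply: eq_bigr => w _.
by rewrite IH mulrBr mulr1.
Qed.

Lemma output_prob_ge0 G E t : 0 <= output_prob G E t.
Proof.
elim: t => [q|u len k IH] /=; first by case: asbool.
by apply: sumr_ge0 => w _; rewrite mulr_ge0 ?walk_prob_ge0.
Qed.

Lemma output_prob_le1 G E t : output_prob G E t <= 1.
Proof. by rewrite -subr_ge0 -output_prob_setC output_prob_ge0. Qed.

Lemma le_output_prob G E E' t : (E `<=` E')%classic ->
  output_prob G E t <= output_prob G E' t.
Proof.
move=> EE'; elim: t => [q|u len k IH] /=.
  rewrite ler_nat; case: (asboolP (E q)) => [/EE'|//].
  by move/asboolT => ->.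
by apply: ler_sum => w _; rewrite ler_wpM2l ?walk_prob_ge0.
Qed.

(* Tensorization: each step multiplies the affinity of the two transcripts by r,
   and reading off an event can only increase it. *)
Lemma affinity_output_prob G G' (r : R) E t : 0 <= r <= 1 ->
  (forall v, \sum_v' Num.sqrt (step_prob G v v' * step_prob G' v v') = r) ->
  r ^+ total_steps t <= affinity (output_prob G E t) (output_prob G' E t).
Proof.
move=> /andP[r0 r1] rE; elim: t => [q|u len k IH] /=.
  rewrite /affinity expr0; case: asbool;
  by rewrite ?subrr ?subr0 ?mulr0 ?mulr1 ?sqrtr0 ?sqrtr1 ?addr0 ?add0r.
set M := (\max_w _)%N.
set a := \sum_w _; set c := \sum_w _.
have aC : 1 - a = \sum_w walk_prob G u w * output_prob G (~` E)%classic (k w).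
  exact/esym/(output_prob_setC G E (Walk u k)).
have cC : 1 - c = \sum_w walk_prob G' u w * output_prob G' (~` E)%classic (k w).
  exact/esym/(output_prob_setC G' E (Walk u k)).
have pos H F w : 0 <= walk_prob H u w * output_prob H F (k w).
  by rewrite mulr_ge0 ?walk_prob_ge0 ?output_prob_ge0.
rewrite /affinity aC cC.
(* Cauchy-Schwarz over the walks, for [E] and for its complement, leaves for each walk the affinity
   of the continuations. *)
apply: le_trans (lerD (sum_sqrtrM (pos G E) (pos G' E))
  (sum_sqrtrM (pos G (~` E)%classic) (pos G' (~` E)%classic))).
rewrite -big_split exprD -(sum_sqrt_walk_prob u len rE) mulr_suml.
apply: ler_sum => w _ /=.
rewrite [X in _ <= Num.sqrt X + _]mulrACA [X in _ <= _ + Num.sqrt X]mulrACA.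
have pq0 : 0 <= walk_prob G u w * walk_prob G' u w.
  by rewrite mulr_ge0 ?walk_prob_ge0.
rewrite (sqrtrM (_ * output_prob G' E _)) //
  (sqrtrM (_ * output_prob G' _ _)) //.
rewrite -mulrDr ler_wpM2l ?sqrtr_ge0 //.
rewrite !output_prob_setC; apply: le_trans (IH w).
(* [M] is the costliest continuation and [r <= 1], so [r ^+ M] is below the power for each [k w]. *)
by rewrite ler_wiXn2l //; exact: (leq_bigmax_cond w).
Qed.

(** Squared affinity at least 3/4 keeps the two probabilities of [E] within 1/2 of each other, and
    on [G'] disjointness bounds [E'] by the complement of [E]. *)
Lemma output_prob_disjoint_le G G' (r : R) E E' t (s : nat) : 0 <= r <= 1 ->
  (forall v, \sum_v' Num.sqrt (step_prob G v v' * step_prob G' v v') = r) ->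
  (total_steps t <= s)%N -> 3 / 4 <= (r ^+ s) ^+ 2 ->
  (E `<=` ~` E')%classic ->
  output_prob G E t + output_prob G' E' t <= 3 / 2.
Proof.
move=> r01 rE ts hs EE'.
have /andP[r0 r1] := r01.
have le_rs : r ^+ s <= affinity (output_prob G E t) (output_prob G' E t).
  apply: le_trans (affinity_output_prob E t r01 rE).
  by rewrite ler_wiXn2l.
have {}hs : 3 / 4 <= affinity (output_prob G E t) (output_prob G' E t) ^+ 2.
  apply: le_trans hs _.
  by rewrite ler_pXn2r ?nnegrE // ?exprn_ge0 //;
    apply: le_trans le_rs; rewrite exprn_ge0.
have := @sqr_affinity_le _ (output_prob G E t) (output_prob G' E t).
rewrite !output_prob_ge0 !output_prob_le1 => /(_ isT isT) tv.
have : output_prob G' E' t <= 1 - output_prob G' E t.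
  by rewrite -output_prob_setC le_output_prob // => q E'q /EE'.
have : (output_prob G E t - output_prob G' E t) ^+ 2 <= (1 / 2) ^+ 2 by lra.
nra.
Qed.

End Walks.

(** * Wasserstein distance and the first absolute moment *)

Section Transport.
Context {R : realType}.
Notation line := (measurableTypeR R).
Local Open Scope ereal_scope.
Implicit Types p q : probability line R.

Let measurable_normE : measurable_fun [set: line] (fun x : line => `|x|%:E).
Proof. by apply/measurable_EFinP; exact: normr_measurable. Qed.

Lemma ge0_integral_coupling p q pi (f : line -> \bar R) : coupling p q pi ->
  measurable_fun [set: line] f -> (forall x, 0 <= f x) ->
  \int[pi]_z f z.1 = \int[p]_x f x /\ \int[pi]_z f z.2 = \int[q]_x f x.
Proof.
move=> [pi1 pi2] mf f0; split.
- transitivity (\int[pushforward pi fst]_x f x).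
    rewrite ge0_integral_pushforward //; exact: measurable_fst.
  apply: eq_measure_integral => B mB _.
  transitivity (pi (B `*` setT)%classic); last exact: pi1.
  rewrite /= /pushforward.
  by congr (pi _); apply/seteqP; split => // -[x y] [].
- transitivity (\int[pushforward pi snd]_x f x).
    rewrite ge0_integral_pushforward //; exact: measurable_snd.
  apply: eq_measure_integral => B mB _.
  transitivity (pi (setT `*` B)%classic); last exact: pi2.
  rewrite /= /pushforward.
  by congr (pi _); apply/seteqP; split => // -[x y] [].
Qed.

Let measurable_cost :
  measurable_fun [set: line * line] (fun z : line * line => `|z.1 - z.2|%:E).
Proof.
apply/measurable_EFinP.
apply: (measurableT_comp (@normr_measurable R setT)).
apply: measurable_funB; [exact: measurable_fst|exact: measurable_snd].
Qed.

Lemma integral_norm_coupling p q pi : coupling p q pi ->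
  \int[p]_x `|x|%:E <= \int[q]_x `|x|%:E + \int[pi]_z `|z.1 - z.2|%:E /\
  \int[q]_x `|x|%:E <= \int[p]_x `|x|%:E + \int[pi]_z `|z.1 - z.2|%:E.
Proof.
move=> cpl.
have norm0 (x : line) : 0 <= `|x|%:E by rewrite lee_fin.
have [<- <-] := ge0_integral_coupling cpl measurable_normE norm0.
have m1 := measurableT_comp measurable_normE (@measurable_fst _ _ line line).
have m2 := measurableT_comp measurable_normE (@measurable_snd _ _ line line).
rewrite -!ge0_integralD //; split; apply: ge0_le_integral => //.
- exact: emeasurable_funD.
- move=> [x y] _ /=; rewrite -EFinD lee_fin addrC -{1}(subrK y x).
  exact: ler_normD.
- exact: emeasurable_funD.
- move=> [x y] _ /=; rewrite -EFinD lee_fin addrC distrC -{1}(subrK x y).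
  exact: ler_normD.
Qed.

Lemma le_add_W1 p q (a b : \bar R) : 0 <= b ->
  (forall pi, coupling p q pi -> a <= b + \int[pi]_z `|z.1 - z.2|%:E) ->
  a <= b + W1 p q.
Proof.
move=> b0 le_ab; have W0 : 0 <= W1 p q.
  by apply/ereal_infP => _ [pi _ <-];
    apply: integral_ge0 => z _; rewrite lee_fin.
(* For [b = +oo] the right side is [+oo], since [W1] is nonnegative and so not [-oo]. A finite [b]
   can be moved across before taking the infimum. *)
case: b b0 le_ab => [b| |] // _ le_ab; last first.
  by rewrite addye ?leey // gt_eqF // (lt_le_trans _ W0).
rewrite -leeBlDl //; apply/ereal_infP => _ [pi cpl <-].
by rewrite leeBlDl // le_ab.
Qed.

(** The elementary half of Kantorovich-Rubinstein duality, for the 1-Lipschitz test function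
    [|x|]. *)
Lemma integral_norm_W1 p q :
  \int[p]_x `|x|%:E <= \int[q]_x `|x|%:E + W1 p q /\
  \int[q]_x `|x|%:E <= \int[p]_x `|x|%:E + W1 p q.
Proof.
by split; apply: le_add_W1 => [|pi /integral_norm_coupling[]//];
  apply: integral_ge0 => x _; rewrite lee_fin.
Qed.

Lemma integral_norm_W1_both p p' q (a a' e : R) :
  \int[p]_x `|x|%:E = a%:E -> \int[p']_x `|x|%:E = a'%:E ->
  W1 p q <= e%:E -> W1 p' q <= e%:E -> (a' <= a + e + e)%R.
Proof.
move=> pE p'E W_p W_p'.
have [_ q_p] := integral_norm_W1 p q.
have [p'_q _] := integral_norm_W1 p' q.
have := le_trans p'_q (leeD (le_trans q_p (leeD (lexx _) W_p)) W_p').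
by rewrite pE p'E -!EFinD lee_fin.
Qed.

Lemma integral_norm_spectral_density n (G : wgraph R n.+1) :
  \int[spectral_density G : probability line R]_x `|x|%:E =
  (n.+1%:R^-1 * \sum_(l <- eigenvalues G) `|l|)%:E.
Proof.
rewrite ge0_integral_mscale //= ge0_integral_measure_sum //.
rewrite (eq_bigr (fun k : 'I_n.+1 => `|nth 0%R (eigenvalues G) k|%:E));
  last first.
  by move=> k _; rewrite integral_dirac // diracT mul1e.
rewrite sumEFin -EFinM; congr (_ * _)%:E.
by rewrite [RHS](big_nth 0%R) size_eigenvalues big_mkord.
Qed.

End Transport.

(** * Spectrum of the weighted 4-cycle *)

Lemma eq_char_poly_conj (F : fieldType) n (H A B : 'M[F]_n) : H \in unitmx ->
  H *m A = B *m H -> char_poly A = char_poly B.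
Proof.
move=> uH HA; rewrite /char_poly /char_poly_mx.
have uPH : \det (map_mx polyC H) != 0.
  by rewrite det_map_mx polyC_eq0 -unitfE -unitmxE.
apply: (mulfI uPH); rewrite [RHS]mulrC -!det_mulmx.
rewrite mulmxBr mulmxBl -!map_mxM HA; congr (\det (_ - _)).
by rewrite mul_mx_scalar mul_scalar_mx.
Qed.

Section WeightedCycle.
Context {R : realType} (dl : R) (dl_small : `|dl| < 1 / 2).

(* The 4-cycle 0-1-2-3-0 with weights 1/2 + dl on 01, 23 and 1/2 - dl on 12, 30:
   edges are told apart by the sum of their endpoints. *)
Definition cycle4_weight : 'M[R]_4 :=
  \matrix_(i, j) match (i + j)%N with
                 | 1 | 5 => 1 / 2 + dl
                 | 3 => 1 / 2 - dl
                 | _ => 0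
                 end.

Lemma cycle4_weight_sym : cycle4_weight^T = cycle4_weight.
Proof. by apply/matrixP => i j; rewrite !mxE addnC. Qed.

Lemma cycle4_weight_ge0 i j : 0 <= cycle4_weight i j.
Proof.
move: dl_small; rewrite mxE ltr_norml => /andP[? ?].
by case: (i + j)%N => [|[|[|[|[|[|?]]]]]] //; lra.
Qed.

Lemma cycle4_weight_loopless i : cycle4_weight i i = 0.
Proof. by rewrite mxE; case: i => -[|[|[|[|]]]]. Qed.

(** Every vertex meets one edge of each weight. With all degrees 1, the weights are both the
    normalized adjacency entries and the step probabilities. *)
Lemma sum_cycle4_weight i : \sum_j cycle4_weight i j = 1.
Proof.
rewrite !big_ord_recl big_ord0 !mxE /=.
by case: i => -[|[|[|[|//]]]] ? /=; lra.
Qed.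

Lemma cycle4_weight_deg_gt0 i : 0 < \sum_j cycle4_weight i j.
Proof. by rewrite sum_cycle4_weight. Qed.

Definition cycle4 : wgraph R 4 :=
  WGraph cycle4_weight_sym cycle4_weight_ge0 cycle4_weight_loopless
    cycle4_weight_deg_gt0.

Lemma degree_cycle4 i : degree cycle4 i = 1.
Proof. exact: sum_cycle4_weight. Qed.

Lemma step_prob_cycle4 i j : step_prob cycle4 i j = cycle4_weight i j.
Proof. by rewrite /step_prob degree_cycle4 divr1. Qed.

Lemma normalized_adjacency_cycle4 :
  normalized_adjacency cycle4 = cycle4_weight.
Proof.
rewrite /normalized_adjacency /inv_sqrt_degree.
have -> : \row_i (Num.sqrt (degree cycle4 i))^-1 = const_mx 1 :> 'rV[R]_4.
  by apply/rowP => i; rewrite !mxE degree_cycle4 sqrtr1 invr1.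
by rewrite diag_const_mx mul1mx mulmx1.
Qed.

(* The rows are eigenvectors of every weighted cycle4. *)
Definition hadamard4 : 'M[R]_4 :=
  \matrix_(i, j) nth 0 (nth [::] [:: [:: 1; 1; 1; 1]; [:: 1; -1; 1; -1];
                                   [:: 1; 1; -1; -1]; [:: 1; -1; -1; 1]] i) j.

Definition cycle4_spectrum : seq R := [:: 1; -1; dl *+ 2; - (dl *+ 2)].

Lemma hadamard4_unit : hadamard4 \in unitmx.
Proof.
(* The matrix is symmetric and squares to 4 times the identity. *)
suff [] : hadamard4 \in unitmx /\ (4^-1 *: hadamard4) \in unitmx by [].
apply/mulmx1_unit/matrixP => i j.
rewrite !mxE !big_ord_recl big_ord0 !mxE.
case: i => -[|[|[|[|//]]]] ?; case: j => -[|[|[|[|//]]]] ? /=; lra.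
Qed.

Lemma hadamard4_cycle4 : hadamard4 *m cycle4_weight =
  diag_mx (\row_i nth 0 cycle4_spectrum i) *m hadamard4.
Proof.
rewrite mul_diag_mx; apply/matrixP => i j.
rewrite !mxE !big_ord_recl big_ord0 !mxE.
case: i => -[|[|[|[|//]]]] ?; case: j => -[|[|[|[|//]]]] ? /=; lra.
Qed.

(** [eigenvalues] comes from a chosen factorization, which unique factorization determines only up
    to order. *)
Lemma eigenvalues_cycle4 : perm_eq (eigenvalues cycle4) cycle4_spectrum.
Proof.
apply: prod_XsubC_eq; rewrite -eigenvaluesP normalized_adjacency_cycle4.
rewrite (eq_char_poly_conj hadamard4_unit hadamard4_cycle4).
rewrite char_poly_trig ?diag_mx_is_trig //.
rewrite [RHS](big_nth 0) big_mkord; apply: eq_bigr => i _.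
by rewrite !mxE eqxx mulr1n.
Qed.

Lemma integral_norm_cycle4 :
  (\int[spectral_density cycle4 : probability (measurableTypeR R) R]_x `|x|%:E =
   ((1 + `|dl| *+ 2) / 2)%:E)%E.
Proof.
rewrite integral_norm_spectral_density (perm_big _ eigenvalues_cycle4) /=.
rewrite !big_cons big_nil !normrN normr1 normrMn; congr EFin.
by field.
Qed.

End WeightedCycle.

(** * Telling the flat and the bent cycle apart *)

Lemma norm0_lt_half {R : realType} : `|0 : R| < 1 / 2.
Proof. by rewrite normr0; lra. Qed.

Section Distinguishing.
Context {R : realType} (dl : R) (dl_small : `|dl| < 1 / 2).

Let flat : wgraph R 4 := cycle4 norm0_lt_half.
Let bent := cycle4 dl_small.

(** This is [affinity (1 / 2) (1 / 2 + dl)], comparing a fair step with a biased one. *)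
Definition step_affinity : R :=
  Num.sqrt (1 / 2 * (1 / 2 + dl)) + Num.sqrt (1 / 2 * (1 / 2 - dl)).

Lemma sum_sqrt_step_prob v :
  \sum_v' Num.sqrt (step_prob flat v v' * step_prob bent v v') = step_affinity.
Proof.
under eq_bigr do rewrite !step_prob_cycle4.
rewrite !big_ord_recl big_ord0 !mxE /step_affinity.
by case: v => -[|[|[|[|//]]]] ? /=;
  rewrite !(addr0, subr0, mulr0, sqrtr0, add0r) // addrC.
Qed.

Lemma step_affinity01 : 0 <= step_affinity <= 1.
Proof.
move: dl_small; rewrite ltr_norml => /andP[? ?].
rewrite addr_ge0 ?sqrtr_ge0 //=.
have -> : 1 = Num.sqrt ((1 / 2 + 1 / 2) * ((1 / 2 + dl) + (1 / 2 - dl))) :> R.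
  rewrite [X in Num.sqrt X](_ : _ = 1) ?sqrtr1 //; lra.
by apply: sqrtrM_add; lra.
Qed.

Lemma sqr_step_affinity_ge : 1 - dl ^+ 2 *+ 2 <= step_affinity ^+ 2.
Proof.
have small := dl_small; move: dl_small; rewrite ltr_norml => /andP[? ?].
rewrite /step_affinity sqrrD !sqr_sqrtr; try lra.
rewrite -sqrtrM; last lra.
set x := _ * _ * (_ * _).
(* The squared affinity is [1/2 + 2 sqrt x] with [x = 1/4 (1/4 - dl^2)], so [sqrt x >= 1/4 - dl^2]
   suffices. *)
have x_ge : (1 / 4 - dl ^+ 2) ^+ 2 <= x.
  have : dl ^+ 2 < (1 / 2) ^+ 2.
    by rewrite -(real_normK (num_real dl)) ltr_pXn2r ?nnegrE //; lra.
  have := sqr_ge0 dl.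
  rewrite /x; nra.
have : 1 / 4 - dl ^+ 2 <= Num.sqrt x.
  apply: le_trans (ler_norm _) _.
  by rewrite -sqrtr_sqr ler_wsqrtr.
lra.
Qed.

(** The means of [|x|] are [1/2] and [1/2 + |dl|], so a common [q] would force [|dl| <= 2 eps]. *)
Lemma spectral_density_cycle4_disjoint (eps : R) : eps *+ 2 < `|dl| ->
  ([set q | (W1 (spectral_density flat : probability _ _) q <= eps%:E)%E] `<=`
   ~` [set q |
      (W1 (spectral_density bent : probability _ _) q <= eps%:E)%E])%classic.
Proof.
move=> lt_eps q /= W_flat W_bent.
have := integral_norm_W1_both (integral_norm_cycle4 norm0_lt_half)
  (integral_norm_cycle4 dl_small) W_flat W_bent.
rewrite normr0; lra.
Qed.

End Distinguishing.

(** * Averaging over the random seed, and conclusion *)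

Lemma ge0_integral_add_le (d : measure_display) (T : measurableType d)
    (R : realType) (P : probability T R) (f g : T -> R) (c : R) :
  measurable_fun [set: T] f -> measurable_fun [set: T] g ->
  (forall w, 0 <= f w) -> (forall w, 0 <= g w) -> (forall w, f w + g w <= c) ->
  (\int[P]_w (f w)%:E + \int[P]_w (g w)%:E <= c%:E)%E.
Proof.
move=> mf mg f0 g0 fg.
have mfE : measurable_fun [set: T] (EFin \o f) by apply/measurable_EFinP.
have mgE : measurable_fun [set: T] (EFin \o g) by apply/measurable_EFinP.
rewrite -ge0_integralD //; try by move=> w _; rewrite lee_fin.
have -> : (c%:E = \int[P]_w (cst c%:E) w)%E.
  transitivity (c%:E * P setT)%E; last by rewrite integral_cst.
  by rewrite probability_setT mule1.
apply: ge0_le_integral => //.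
- by move=> w _; rewrite adde_ge0 ?lee_fin.
- exact: emeasurable_funD.
- by move=> w _; rewrite -EFinD lee_fin.
Qed.

Theorem theorem20 (R : realType) (eps : R) (s : nat)
    (d : measure_display) (T : measurableType d) (P : probability T R)
    (A : algorithm R T) :
  0 < eps -> eps < 1 / 6 ->
  (forall (w : T) (n : nat), (total_steps (A w n) <= s)%N) ->
  (forall (n : nat) (G : wgraph R n.+1),
     measurable_fun setT (success_prob A eps G)) ->
  (forall (n : nat) (G : wgraph R n.+1),
     ((3 / 4)%:E < \int[P]_w (success_prob A eps G w)%:E)%E) ->
  1 / (36 * eps ^+ 2) <= s%:R.
Proof.
move=> eps0 eps6 steps mA succ; rewrite leNgt; apply/negP => lt_s.
have eps2 : 0 < 36 * eps ^+ 2 by rewrite mulr_gt0 ?exprn_gt0.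
have {}lt_s : s%:R * (36 * eps ^+ 2) < 1 by rewrite -ltr_pdivlMr.
(* A factor [c] needs [c > 2] for disjointness and [c^2 <= 9/2] for [2 s dl^2 <= 1/4]; 2.1 meets
   both. *)
pose dl := 21 / 10 * eps.
have dl0 : 0 <= dl by rewrite /dl; lra.
have dl_small : `|dl| < 1 / 2 by rewrite ger0_norm // /dl; lra.
have lt_eps : eps *+ 2 < `|dl| by rewrite ger0_norm // /dl; lra.
have rs : 3 / 4 <= (step_affinity dl ^+ s) ^+ 2.
  rewrite exprAC; have x01 : 0 <= dl ^+ 2 *+ 2 <= 1.
    rewrite ger0_norm // in dl_small.
    by apply/andP; split; nra.
  apply: le_trans (_ : (1 - dl ^+ 2 *+ 2) ^+ s <= _); last first.
    have /andP[_ x1] := x01.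
    by apply: lerXn2r (sqr_step_affinity_ge dl_small);
      rewrite nnegrE ?sqr_ge0 ?subr_ge0.
  (* Here [2 s dl^2 = 8.82 s eps^2 < 8.82 / 36 < 1/4]. *)
  apply: le_trans (bernoulli_le s x01); rewrite -[_ *+ s]mulr_natl /dl; nra.
(* For each seed the two success probabilities sum to at most 3/2, hence so do their means, each
   supposed above 3/4. The index 3 stands for 4 vertices. *)
have := ge0_integral_add_le P
  (mA 3 (cycle4 norm0_lt_half)) (mA 3 (cycle4 dl_small))
  (fun w => output_prob_ge0 _ _ _) (fun w => output_prob_ge0 _ _ _)
  (fun w => output_prob_disjoint_le (step_affinity01 dl_small)
     (sum_sqrt_step_prob dl_small) (steps w 3) rs
     (spectral_density_cycle4_disjoint lt_eps)).
apply/negP; rewrite -ltNge.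
apply: le_lt_trans
  (lteD (succ 3 (cycle4 norm0_lt_half)) (succ 3 (cycle4 dl_small))).
by rewrite -EFinD lee_fin; lra.
Qed.
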